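(* Let $f=(f_1,\dots,f_N)$ be a polynomial system in $\mathbb{C}[x_1,\dots,x_n]$ with $N\ge n$, let $g$ be a square subsystem of $f$, and let $d\in\mathbb{N}$ satisfy $d=\#\bigl(\mathcal{V}(g)\setminus\mathcal{V}(f)\bigr)$. Let $S=\{\hat\zeta_1,\dots,\hat\zeta_m\}$ be a set of pairwise distinct approximate solutions to $g$ (their associated solutions are pairwise distinct). Consider the algorithm that, on input $(f,g,d,S)$, forms $$R=\{\hat\zeta_j\in S : \delta(f,g,\hat\zeta_j)>0\},$$ and outputs $T=S\setminus R$ if $\#R=d$, and $T=\emptyset$ otherwise. Then the output $T$ consists of approximate solutions to $f$.
   Context: For a polynomial system $h$ in $n$ variables, $\mathcal{V}(h)\subset\mathbb{C}^n$ is the set of common zeros; $h$ is square if it consists of $n$ polynomials. A square subsystem of $f$ is a square system $g$ whose solutions include the solutions of $f$, i.e. $\mathcal{V}(f)\subset\mathcal{V}(g)$. $\|\cdot\|$ is the usual Hermitian norm on $\mathbb{C}^n$. Approximate solution: an approximate solution to $h$ is a triple $(\hat\zeta,\rho,\mathcal{N})$ with $\hat\zeta\in\mathbb{C}^n$, $\rho\in\mathbb{R}_{>0}$, and $\mathcal{N}\colon U\to\mathbb{C}^n$ a map on some $U\subset\mathbb{C}^n$ (the refinement operator), such that (1) there exists $\zeta\in\mathcal{V}(h)$ with $\|\zeta-\hat\zeta\|<\rho$, and (2) all iterates $\mathcal{N}^k(\hat\zeta)$ are defined and converge to this $\zeta$ as $k\to\infty$. The point $\zeta$ is the solution associated to $\hat\zeta$.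 One refers to $\hat\zeta$ itself as the approximate solution when $\rho$ and $\mathcal{N}$ are understood. Here each $\hat\zeta_j\in S$ comes with its radius $\rho_j$ and the refinement operator $\mathcal{N}_g$ for $g$; elements of $T$ are approximate solutions to $f$ with these same radii and with $\mathcal{N}_g$ as refinement operator. Taylor residual: $S^k\mathbb{C}^n$ carries the norm dual to the standard unitarily invariant norm on homogeneous polynomials of degree $k$, which satisfies $\|z^k\|\le\|z\|^k$; the $k$-th derivative of a polynomial $p$ at a point $q$ is viewed as a linear map $(D^kp)_q\colon S^k\mathbb{C}^n\to\mathbb{C}$ with operator norm $\|(D^kp)_q\|=\max_{\|w\|=1}|(D^kp)_q(w)|$. For a polynomial $p$ put $$\delta(p,g,\hat\zeta_j)=|p(\hat\zeta_j)|-\sum_{k=1}^{\deg p}\frac{\|(D^kp)_{\hat\zeta_j}\|}{k!}\,\rho_j^k,$$ and for the system $f$ put $\delta(f,g,\hat\zeta_j)=\max_{1\le i\le N}\delta(f_i,g,\hat\zeta_j)$. *)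

(* Defs.v *)
From HB Require Import structures.
From mathcomp Require Import all_boot all_order all_algebra complex mpoly finmap.
From mathcomp Require Import boolp classical_sets cardinality reals ereal.
From mathcomp Require Import topology.

Set Implicit Arguments.
Unset Strict Implicit.
Unset Printing Implicit Defensive.

Import Order.TTheory GRing.Theory Num.Theory.
Import numFieldTopology.Exports.

Local Open Scope ring_scope.
Local Open Scope classical_set_scope.

Section SquareSubsystems.
Variable R : realType.
Local Notation C := R[i].

Definition cabs (z : C) : R := ComplexField.Normc.normc z.

Definition hnorm n (z : 'rV[C]_n) : R :=
  Num.sqrt (\sum_(i < n) cabs (z 0 i) ^+ 2).

Definition zeros n N (h : 'I_N -> {mpoly C[n]}) : set 'rV[C]_n :=
  [set z | forall i, (h i).@[z 0] = 0].

Definition square_subsystem n N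
    (f : 'I_N -> {mpoly C[n]}) (g : 'I_n -> {mpoly C[n]}) : Prop :=
  zeros f `<=` zeros g.

(* A refinement operator is a partial map: its domain U is the set of points
   that are not sent to None. *)
Definition refinement n := 'rV[C]_n -> option 'rV[C]_n.

Definition iterate n (Nop : refinement n) (k : nat) (z : 'rV[C]_n) :
    option 'rV[C]_n :=
  iter k (obind Nop) (Some z).

Definition associated_solution n N (h : 'I_N -> {mpoly C[n]})
    (zhat : 'rV[C]_n) (rho : R) (Nop : refinement n) (zeta : 'rV[C]_n) : Prop :=
  [/\ zeros h zeta,
      hnorm (zeta - zhat) < rho &
      exists2 z : nat -> 'rV[C]_n,
        (forall k, iterate Nop k zhat = Some (z k)) &
        hnorm (z k - zeta) @[k --> \oo] --> (0 : R)].

Definition approximate_solution n N (h : 'I_N -> {mpoly C[n]})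
    (zhat : 'rV[C]_n) (rho : R) (Nop : refinement n) : Prop :=
  0 < rho /\ exists zeta, associated_solution h zhat rho Nop zeta.

(* [dhomog n C k] is used both for homogeneous polynomials of degree k on C^n
   and for the symmetric power S^k C^n.  In the latter role 'X_i stands for the
   i-th vector e_i of the standard basis of C^n, so that 'X_[m] is the symmetric
   product of the e_i with multiplicities m, and the power z^k of a vector z is
   (\sum_i z 0 i *: 'X_i) ^+ k. *)
Definition symtensor (n k : nat) : Type := dhomog n C k.

(* m! / k!, the inverse of the multinomial coefficient when m has degree k *)
Definition multinom_inv n (k : nat) (m : 'X_{1..n}) : R :=
  (\prod_(i < n) (m i)`!)%:R / k`!%:R.

(* The standard unitarily invariant (Bombieri-Weyl) norm. *)
Definition unitary_norm n k (h : dhomog n C k) : R :=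
  Num.sqrt (\sum_(m <- msupp h) multinom_inv k m * cabs h@_m ^+ 2).

(* A homogeneous polynomial h of degree k as a linear form on S^k C^n: this is
   the linear form whose value at z^k is h.@[z 0], the coefficient of z^k at
   'X_[m] being (k! / m!) z^m. *)
Definition sym_pairing n k (h : dhomog n C k) (w : symtensor n k) : C :=
  \sum_(m <- msupp w) (multinom_inv k m)%:C%C * h@_m * w@_m.

Definition sym_norm n k (w : symtensor n k) : R :=
  sup [set cabs (sym_pairing h w) | h in [set h | unitary_norm h = 1]].

Definition sym_deriv n k (p : {mpoly C[n]}) (q : 'rV[C]_n)
    (w : symtensor n k) : C :=
  \sum_(m <- msupp w) w@_m * (p^`M[m]).@[q 0].

(* The supremum is a maximum, except that it is 0 when n = 0 < k, where
   S^k C^n = 0 has no unit vector. *)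
Definition sym_deriv_norm n (k : nat) (p : {mpoly C[n]}) (q : 'rV[C]_n) : R :=
  sup [set cabs (sym_deriv p q w) | w in [set w : symtensor n k | sym_norm w = 1]].

(* msize p is 1 + deg p for p != 0 *)
Definition taylor_residual n (p : {mpoly C[n]}) (zhat : 'rV[C]_n) (rho : R) : R :=
  cabs p.@[zhat 0] -
    \sum_(1 <= k < msize p) sym_deriv_norm k p zhat / k`!%:R * rho ^+ k.

(* Valued in the extended reals only so that the maximum over an empty system
   makes sense. *)
Definition system_residual n N (f : 'I_N -> {mpoly C[n]})
    (zhat : 'rV[C]_n) (rho : R) : \bar R :=
  \big[maxe/-oo%E]_(i < N) (taylor_residual (f i) zhat rho)%:E.

(* The square system g enters only through the radii rho of its approximate
   solutions. *)
Definition rejected n N (f : 'I_N -> {mpoly C[n]}) (S : {fset 'rV[C]_n})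
    (rho : 'rV[C]_n -> R) : {fset 'rV[C]_n} :=
  [fset z in S | (0%:E < system_residual f z (rho z))%E]%fset.

Definition certified n N (f : 'I_N -> {mpoly C[n]}) (d : nat)
    (S : {fset 'rV[C]_n}) (rho : 'rV[C]_n -> R) : {fset 'rV[C]_n} :=
  if #|` rejected f S rho| == d then (S `\` rejected f S rho)%fset else fset0.

End SquareSubsystems.

(* Main.v *)
(* By the Cauchy-Schwarz inequality the dual norm on S^k C^n is given by the same
   formula as the unitarily invariant norm, so that z^k has norm exactly ‖z‖^k.
   If p(z) = 0 and ‖z - q‖ < r, the Taylor expansion of p at q therefore gives
   |p(q)| <= \sum_(k >= 1) ‖(D^k p)_q‖ r^k / k!; hence a rejected point is
   associated to a zero of g that is not a zero of f.  Associated solutions being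
   distinct, d rejected points exhaust V(g) \ V(f), so every remaining point is
   associated to a zero of f. *)
Require Import Defs.
From HB Require Import structures.
From mathcomp Require Import all_boot all_order all_algebra complex mpoly finmap.
From mathcomp Require Import boolp classical_sets cardinality reals ereal.
From mathcomp Require Import topology.
From mathcomp Require Import ssrcomplements ring.

Set Implicit Arguments.
Unset Strict Implicit.
Unset Printing Implicit Defensive.

Import Order.TTheory GRing.Theory Num.Theory.
Import numFieldTopology.Exports.

Local Open Scope ring_scope.
Local Open Scope classical_set_scope.

(** Supports vary with the polynomial; over a common index set, sums attached to different
    polynomials can be compared term by term. *)
Lemma sum_msupp_wide (A : nzRingType) (V : nmodType) n (w : {mpoly A[n]}) k
    (F : 'X_{1..n} -> V) :
  (msize w <= k)%N -> (forall m, w@_m = 0 -> F m = 0) ->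
  \sum_(m <- msupp w) F m = \sum_(m : 'X_{1..n < k}) F m.
Proof.
move=> wk F0; rewrite (big_mksub 'X_{1..n < k}) //=; first last.
- by move=> m /msize_mdeg_lt /leq_trans; apply.
- exact: msupp_uniq.
by rewrite big_rmcond //= => m /memN_msupp_eq0; apply: F0.
Qed.

Lemma msize_homog (A : nzRingType) n (p : {mpoly A[n]}) k :
  p \is k.-homog -> (msize p <= k.+1)%N.
Proof.
by move=> pk; apply/bigmax_leqP_seq => m mp _; rewrite (dhomog_mf pk mp).
Qed.

(** * Symmetric tensors as differential operators, and Taylor's formula *)

Section DirectionalDerivative.
Variables (A : comNzRingType) (n : nat).
Implicit Types (v z : 'I_n -> A) (p q w : {mpoly A[n]}) (m : 'X_{1..n}).

Definition linform v : {mpoly A[n]} := \sum_i v i *: 'X_i.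

Definition dirderiv v p : {mpoly A[n]} := \sum_i v i *: p^`M(i).

(** The tensor [w] acts as a constant-coefficient operator, ['X_i] standing for the i-th partial
    derivative. The result stays a polynomial so that such operators compose; [sym_deriv] is its
    value at a point. *)
Definition diffop p w : {mpoly A[n]} := \sum_(m <- msupp w) w@_m *: p^`M[m].

Lemma diffop_wide p w k : (msize w <= k)%N ->
  diffop p w = \sum_(m : 'X_{1..n < k}) w@_m *: p^`M[m].
Proof. by move=> wk; apply: sum_msupp_wide => // m ->; rewrite scale0r. Qed.

Lemma diffop_is_linear p : linear (diffop p).
Proof.
move=> c w1 w2.
pose k := maxn (msize (c *: w1 + w2)) (maxn (msize w1) (msize w2)).
rewrite !(@diffop_wide _ _ k) ?leq_max ?leqnn ?orbT //.
rewrite scaler_sumr -big_split; apply: eq_bigr => m _ /=.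
by rewrite mcoeffD mcoeffZ scalerDl scalerA.
Qed.

HB.instance Definition _ p := GRing.isLinear.Build A {mpoly A[n]} {mpoly A[n]}
  _ (diffop p) (diffop_is_linear p).

Lemma diffopX m p : diffop p 'X_[m] = p^`M[m].
Proof. by rewrite /diffop msuppX big_seq1 mcoeffX eqxx scale1r. Qed.

(** Products of symbols are compositions of operators: by linearity in [w] it suffices to treat
    monomials, where orders of derivation add up. *)
Lemma diffop_mulXU p w i : diffop p (w * 'X_i) = diffop p^`M(i) w.
Proof.
elim/mpolyind: w => [|c m w _ _ IH]; first by rewrite mul0r !raddf0.
rewrite mulrDl -scalerAl -mpolyXD !linearP /= IH !diffopX.
by rewrite addmC mderivmDm mderivmU1m.
Qed.

Lemma diffop_mul_linform p w v :
  diffop p (w * linform v) = diffop (dirderiv v p) w.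
Proof.
rewrite /linform mulr_sumr raddf_sum /= /dirderiv [RHS]/diffop.
under [RHS]eq_bigr => m _ do rewrite raddf_sum /= scaler_sumr.
rewrite exchange_big; apply: eq_bigr => i _ /=.
rewrite -scalerAr linearZ /= diffop_mulXU.
rewrite scaler_sumr; apply: eq_bigr => m _.
by rewrite mderivmZ !scalerA mulrC.
Qed.

(** Each factor [linform v] is traded for one derivative along [v], so pairing with the tensor v^k
    gives the k-th directional derivative. *)
Lemma diffop_linformX v k p : diffop p (linform v ^+ k) = iter k (dirderiv v) p.
Proof.
elim: k p => [|k IH] p; last by rewrite exprSr diffop_mul_linform IH -iterSr.
by rewrite expr0 -mpolyX0 diffopX mderivm0m.
Qed.

Lemma dirderivM v p q :
  dirderiv v (p * q) = dirderiv v p * q + p * dirderiv v q.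
Proof.
rewrite /dirderiv mulr_suml mulr_sumr -big_split; apply: eq_bigr => i _ /=.
by rewrite mderivM scalerDr scalerAl scalerAr.
Qed.

Lemma dirderiv_is_linear v : linear (dirderiv v).
Proof.
move=> c p q; rewrite /dirderiv scaler_sumr -big_split; apply: eq_bigr => i _ /=.
by rewrite linearP /= scalerDr !scalerA mulrC.
Qed.

HB.instance Definition _ v := GRing.isLinear.Build A {mpoly A[n]} {mpoly A[n]}
  _ (dirderiv v) (dirderiv_is_linear v).

(** The polynomial p(z + t v) in t, which reduces Taylor's formula to one variable. *)
Definition restr_line z v p : {poly A} :=
  mmap (@polyC A) (fun i => (z i)%:P + v i *: 'X) p.

Lemma restr_line_is_linear z v : linear (restr_line z v).
Proof. by move=> c p q; rewrite /restr_line mmapD mmapZ mul_polyC. Qed.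

HB.instance Definition _ z v := GRing.isLinear.Build A {mpoly A[n]} {poly A}
  _ (restr_line z v) (restr_line_is_linear z v).

Lemma restr_lineM z v p q :
  restr_line z v (p * q) = restr_line z v p * restr_line z v q.
Proof. by rewrite /restr_line rmorphM. Qed.

Lemma restr_lineXU z v i : restr_line z v 'X_i = (z i)%:P + v i *: 'X.
Proof. by rewrite /restr_line mmapX mmap1U. Qed.

Lemma restr_line1 z v : restr_line z v 1 = 1.
Proof. by rewrite /restr_line rmorph1. Qed.

(** The chain rule along a line. Both sides obey the same Leibniz rule, so comparing them on 1 and
    on the variables is enough. *)
Lemma deriv_restr_line z v p :
  (restr_line z v p)^`() = restr_line z v (dirderiv v p).
Proof.
have D1 : dirderiv v 1 = 0.
  by rewrite /dirderiv big1 // => i _; rewrite -mpolyC1 mderivC scaler0.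
elim/mpolyind: p => [|c m p _ _ IH]; first by rewrite !raddf0.
rewrite !linearP /= IH; congr (_ *: _ + _).
rewrite mpolyXE_id.
elim/big_ind: _ => [|p1 p2 IH1 IH2|i _].
- by rewrite restr_line1 derivC D1 raddf0.
- by rewrite dirderivM raddfD /= !restr_lineM derivM IH1 IH2.
elim: (m i) => [|k IHk]; first by rewrite expr0 restr_line1 derivC D1 raddf0.
rewrite exprS dirderivM raddfD /= !restr_lineM derivM IHk; congr (_ * _ + _).
rewrite restr_lineXU derivD derivC derivZ derivX add0r alg_polyC.
(* Only the summand [i] survives; there the derivative of ['X_i] appears as ['X_[U_(i) - U_(i)]],
   which is 1. *)
rewrite /dirderiv (bigD1 i) //= big1 ?addr0.
  by rewrite linearZ /= mderivX mnm1E eqxx scale1r -{1}[U_(i)%MM]add0m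
             addmK mpolyX0 restr_line1 alg_polyC.
by move=> j ij; rewrite mderivX mnm1E eq_sym (negPf ij) scale0r scaler0.
Qed.

Lemma derivn_restr_line z v p k :
  (restr_line z v p)^`(k) = restr_line z v (iter k (dirderiv v) p).
Proof.
by elim: k => [|k IH]; rewrite ?derivn0 // derivnS IH deriv_restr_line.
Qed.

Lemma horner_restr_line z v p t :
  (restr_line z v p).[t] = p.@[fun i => z i + v i * t].
Proof.
rewrite mevalE /restr_line /mmap horner_sum; apply: eq_bigr => m _.
rewrite hornerM hornerC /mmap1 horner_prod; congr (_ * _).
by apply: eq_bigr => i _; rewrite horner_exp hornerD hornerC hornerZ hornerX.
Qed.

(** A monomial restricts to a product of [mdeg m] affine factors. The bound lets the one-variable
    expansion stop at [msize p]. *)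
Lemma size_restr_line z v p : (size (restr_line z v p) <= msize p)%N.
Proof.
rewrite /restr_line /mmap; apply: (leq_trans (size_sum _ _ _)).
apply/bigmax_leqP_seq => m mp _.
rewrite mul_polyC; apply: (leq_trans (size_scale_leq _ _)).
apply: leq_trans (msize_mdeg_lt mp); rewrite /mmap1 mdegE.
have sz_mul (q1 q2 : {poly A}) a b : (size q1 <= a.+1)%N ->
    (size q2 <= b.+1)%N -> (size (q1 * q2)%R <= (a + b).+1)%N.
  move=> s1 s2; apply: (leq_trans (size_polyMleq _ _)).
  by have := leq_add s1 s2; rewrite addSn addnS; case: (_ + _)%N.
elim/big_rec2: _ => [|i q k _ sq]; first by rewrite size_poly1.
apply: (sz_mul) => //; elim: (m i) => [|e IHe]; first by rewrite expr0 size_poly1.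
rewrite exprS -[e.+1]add1n; apply: sz_mul => //.
rewrite (leq_trans (size_polyD _ _)) // geq_max.
rewrite (leq_trans (size_polyC_leq1 _)) //.
by rewrite (leq_trans (size_scale_leq _ _)) ?size_polyX.
Qed.

(** Subtraction of exponents is truncated, so for [m i = 0] the index [m - U_(i)] would be [m]
    itself; hence the separate case. *)
Lemma mcoeff_mulXU p m i :
  (p * 'X_i)@_m = if m i == 0%N then 0 else p@_(m - U_(i)).
Proof.
case: eqP => [mi0|/eqP mi]; last first.
  by rewrite -[in LHS](@submK _ U_(i)%MM m) ?lep1mP // addmC mcoeffMX.
apply/memN_msupp_eq0; rewrite (perm_mem (msuppMX _ _)); apply/mapP => -[m' _ mE].
by move: mi0; rewrite mE mnmDE mnm1E eqxx.
Qed.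

Lemma linform_expr_homog v k : linform v ^+ k \is k.-homog.
Proof.
rewrite -[X in _ \is X.-homog]mul1n; apply: dhomogMn; apply: rpred_sum => i _.
by rewrite rpredZ // dhomogX; apply/eqP; exact: mdeg1.
Qed.

(** The multinomial formula, with m! moved to the left so that it holds without division. *)
Lemma mcoeff_linformX v k m :
  (linform v ^+ k)@_m * (\prod_i (m i)`!)%:R =
  if mdeg m == k then k`!%:R * \prod_i v i ^+ m i else 0.
Proof.
elim: k m => [|k IH] m.
  rewrite expr0 mcoeff1 mdeg_eq0; case: eqP => [->|_]; last by rewrite mul0r.
  by rewrite !big1 ?mulr1 // => i _; rewrite mnm0E ?expr0.
rewrite exprSr mulr_sumr raddf_sum /= mulr_suml.
(* Through its summand [v i *: 'X_i], the last factor contributes [m i] times k! v^m. The [m i] add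
   up to k + 1, which turns k! into (k + 1)!. *)
pose G i := (m i)%:R *
  (if mdeg m == k.+1 then k`!%:R * \prod_i v i ^+ m i else 0).
rewrite (eq_bigr G) => [|i _]; last first.
  rewrite -scalerAr mcoeffZ mcoeff_mulXU /G; case: eqP => [->|/eqP mi].
    by rewrite mulr0 !mul0r.
  have le1 : (U_(i) <= m)%MM by rewrite lep1mP.
  pose m' := (m - U_(i))%MM.
  have m'E j : j != i -> m' j = m j.
    by move=> ji; rewrite mnmBE mnm1E eq_sym (negPf ji) subn0.
  have m'i : m i = (m' i).+1 by rewrite mnmBE mnm1E eqxx subn1 prednK ?lt0n.
  have -> : mdeg m = (mdeg m').+1 by rewrite -(submK le1) mdegD mdeg1 addn1.
  have -> : (\prod_j (m j)`!)%N = (m i * \prod_j (m' j)`!)%N.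
    rewrite (bigD1 i) //= [in RHS](bigD1 i) //= mulnA m'i factS; congr (_ * _)%N.
    by apply: eq_bigr => j ji; rewrite m'E.
  have -> : \prod_j v j ^+ m j = v i * \prod_j v j ^+ m' j.
    rewrite (bigD1 i) //= [in RHS](bigD1 i) //= mulrA m'i exprS; congr (_ * _).
    by apply: eq_bigr => j ji; rewrite m'E.
  rewrite natrM eqSS -/m'; have := IH m'; case: eqP => _ E.
    rewrite [k`!%:R * _]mulrCA -E.
    by rewrite -!mulrA [RHS]mulrCA [in RHS](mulrCA (m i)%:R).
  by rewrite mulrACA E !mulr0.
rewrite -mulr_suml -natr_sum -mdegE; case: eqP => [->|_]; last by rewrite mulr0.
by rewrite mulrA -natrM.
Qed.
End DirectionalDerivative.

(** This is the one-variable expansion of [restr_line z v p] at 0, evaluated at 1. *)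
Lemma taylor_diffop (F : numFieldType) n (p : {mpoly F[n]}) (z v : 'I_n -> F) :
  p.@[fun i => z i + v i] =
  \sum_(k < msize p) (diffop p (linform v ^+ k)).@[z] / k`!%:R.
Proof.
have -> : p.@[fun i => z i + v i] = (restr_line z v p).[0 + 1].
  by rewrite horner_restr_line; apply: meval_eq => i; rewrite add0r mulr1.
rewrite (nderiv_taylor_wide (mulrC _ _) (size_restr_line z v p)).
apply: eq_bigr => k _; rewrite expr1n mulr1 diffop_linformX.
have fk : (k`!%:R : F) != 0 by rewrite pnatr_eq0 -lt0n fact_gt0.
(* The normalised derivatives already contain the factor 1/k!; multiplying by k! yields the ordinary
   ones. *)
apply: (mulIf fk); rewrite mulfVK // mulr_natr -hornerMn -nderivn_def.
rewrite derivn_restr_line horner_restr_line; apply: meval_eq => i.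
by rewrite mulr0 addr0.
Qed.

(** With Z the mixed sum and X, Y the two sums of squares, the weighted sum of squares of
    [Y * x i - Z * y i] equals [Y * (X * Y - Z ^+ 2)]. For Y = 0 every product [a i * y i] vanishes,
    hence so does Z. *)
Lemma cauchy_schwarz_weighted (K : realFieldType) (I : finType) (a x y : I -> K) :
  (forall i, 0 <= a i) ->
  (\sum_i a i * (x i * y i)) ^+ 2 <=
  (\sum_i a i * x i ^+ 2) * (\sum_i a i * y i ^+ 2).
Proof.
move=> a0; have aY i : 0 <= a i * y i ^+ 2 by rewrite mulr_ge0 ?sqr_ge0.
set Z := \sum_i _; set X := \sum_i a i * _; set Y := \sum_i a i * _.
have Y0 : 0 <= Y by apply: sumr_ge0.
have [Y_eq0|Yn0] := eqVneq Y 0.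
  suff -> : Z = 0 by rewrite Y_eq0 mulr0 expr0n.
  apply: big1 => i _.
  have /eqP := psumr_eq0P (P := predT) (fun j _ => aY j) Y_eq0 (i := i) isT.
  by rewrite mulf_eq0 sqrf_eq0 => /orP[]/eqP->; rewrite ?mul0r ?mulr0.
have : 0 <= \sum_i a i * (Y * x i - Z * y i) ^+ 2.
  by apply: sumr_ge0 => i _; rewrite mulr_ge0 ?sqr_ge0.
have -> : \sum_i a i * (Y * x i - Z * y i) ^+ 2 = Y * (X * Y - Z ^+ 2).
  have E i : a i * (Y * x i - Z * y i) ^+ 2 = Y ^+ 2 * (a i * x i ^+ 2) +
      - (2 * Y * Z) * (a i * (x i * y i)) + Z ^+ 2 * (a i * y i ^+ 2) by ring.
  rewrite (eq_bigr _ (fun i _ => E i)) !big_split /= -!mulr_sumr -/X -/Y -/Z.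
  by ring.
by rewrite pmulr_rge0 ?subr_ge0 // lt_neqAle eq_sym Yn0.
Qed.

(** * Absolute values, and norms on symmetric powers *)

Section Norms.
Variable R : realType.
Local Notation C := R[i].
Implicit Types (z : C).

Lemma cabs_ge0 z : 0 <= cabs z.
Proof. by case: z => a b; rewrite /cabs /= sqrtr_ge0. Qed.

Lemma cabsM z1 z2 : cabs (z1 * z2) = cabs z1 * cabs z2.
Proof. exact: ComplexField.Normc.normcM. Qed.

Lemma cabs0 : cabs (0 : C) = 0.
Proof. exact: ComplexField.Normc.normc0. Qed.

Lemma cabs1 : cabs (1 : C) = 1.
Proof. exact: ComplexField.Normc.normc1. Qed.

Lemma cabs_real (x : R) : 0 <= x -> cabs x%:C%C = x.
Proof. by move=> x0; rewrite /cabs /= expr0n addr0 sqrtr_sqr ger0_norm. Qed.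

Lemma cabsX z k : cabs (z ^+ k) = cabs z ^+ k.
Proof. by elim: k => [|k IH]; rewrite ?expr0 ?cabs1 // !exprS cabsM IH. Qed.

Lemma cabs_prod (I : finType) (F : I -> C) :
  cabs (\prod_i F i) = \prod_i cabs (F i).
Proof. exact: (big_morph (@cabs R) cabsM cabs1). Qed.

Lemma cabs_sum (I : Type) (r : seq I) (P : pred I) (F : I -> C) :
  cabs (\sum_(i <- r | P i) F i) <= \sum_(i <- r | P i) cabs (F i).
Proof.
elim/big_rec2: _ => [|i x z _ le]; first by rewrite cabs0.
by rewrite (le_trans (le_normcD _ _)) // lerD2l.
Qed.

Lemma cabs_sqr z : (cabs z ^+ 2)%:C%C = z * (z^*)%C.
Proof.
case: z => a b; rewrite /cabs /= sqr_sqrtr ?addr_ge0 ?sqr_ge0 //.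
by simpc; rewrite -!expr2 [b * a]mulrC addNr.
Qed.

Section Degree.
Variables (n k : nat).
Implicit Types (h w : dhomog n C k) (p : {mpoly C[n]}) (q : 'rV[C]_n).

Lemma multinom_inv_gt0 (m : 'X_{1..n}) : 0 < multinom_inv R k m.
Proof.
rewrite /multinom_inv divr_gt0 ?ltr0n ?fact_gt0 // prodn_gt0 // => i.
exact: fact_gt0.
Qed.

Lemma sum_msupp_dhomog (V : nmodType) w (F : 'X_{1..n} -> V) :
  (forall m, w@_m = 0 -> F m = 0) ->
  \sum_(m <- msupp w) F m = \sum_(m : 'X_{1..n < k.+1}) F m.
Proof. exact/sum_msupp_wide/msize_homog/dhomog_is_dhomog. Qed.

Lemma unitary_normE w : unitary_norm w =
  Num.sqrt (\sum_(m : 'X_{1..n < k.+1}) multinom_inv R k m * cabs w@_m ^+ 2).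
Proof.
congr Num.sqrt; rewrite sum_msupp_dhomog // => m ->.
by rewrite cabs0 expr0n mulr0.
Qed.

Lemma sqr_unitary_norm w : unitary_norm w ^+ 2 =
  \sum_(m : 'X_{1..n < k.+1}) multinom_inv R k m * cabs w@_m ^+ 2.
Proof.
rewrite unitary_normE sqr_sqrtr // sumr_ge0 // => m _.
by rewrite mulr_ge0 ?sqr_ge0 ?(ltW (multinom_inv_gt0 _)).
Qed.

Lemma unitary_norm_ge0 w : 0 <= unitary_norm w.
Proof. exact: sqrtr_ge0. Qed.

Lemma unitary_norm_eq0 w : unitary_norm w = 0 -> w = 0.
Proof.
move=> w0; have := sqr_unitary_norm w; rewrite w0 expr0n /= => /esym S0.
apply/val_inj/mpolyP => m /=; rewrite mcoeff0.
(* The sum for the norm sees degrees up to [k] only; beyond that, homogeneity makes the coefficient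
   vanish. *)
have [mk|] := ltnP (mdeg m) k.+1; last first.
  move=> /(leq_trans (msize_homog (dhomog_is_dhomog w))).
  by move=> /msize_mdeg_ge /memN_msupp_eq0.
have a0 (m' : 'X_{1..n < k.+1}) : 0 <= multinom_inv R k m' * cabs w@_m' ^+ 2.
  by rewrite mulr_ge0 ?sqr_ge0 ?(ltW (multinom_inv_gt0 _)).
have /eqP :=
  psumr_eq0P (P := predT) (fun m' _ => a0 m') S0 (i := BMultinom mk) isT.
rewrite mulf_eq0 gt_eqF ?multinom_inv_gt0 //= sqrf_eq0 => /eqP.
exact: ComplexField.Normc.eq0_normc.
Qed.

Lemma unitary_normZ c w : unitary_norm (c *: w) = cabs c * unitary_norm w.
Proof.
apply: (pexpIrn (n := 2)) => //;
  rewrite ?nnegrE ?mulr_ge0 ?unitary_norm_ge0 ?cabs_ge0 //.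
rewrite exprMn !sqr_unitary_norm mulr_sumr; apply: eq_bigr => m _ /=.
by rewrite mcoeffZ cabsM exprMn mulrCA.
Qed.

Lemma sym_pairingE h w : sym_pairing h w =
  \sum_(m : 'X_{1..n < k.+1}) (multinom_inv R k m)%:C%C * h@_m * w@_m.
Proof. by rewrite /sym_pairing sum_msupp_dhomog // => m ->; rewrite mulr0. Qed.

Lemma cabs_sym_pairing_le h w :
  cabs (sym_pairing h w) <= unitary_norm h * unitary_norm w.
Proof.
rewrite sym_pairingE (le_trans (cabs_sum _ _ _)) //.
have a0 (m : 'X_{1..n < k.+1}) : 0 <= multinom_inv R k m.
  exact/ltW/multinom_inv_gt0.
rewrite (eq_bigr (fun m : 'X_{1..n < k.+1} =>
    multinom_inv R k m * (cabs h@_m * cabs w@_m))); last first.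
  by move=> m _; rewrite !cabsM cabs_real // mulrA.
rewrite -(@ler_pXn2r _ 2) ?nnegrE ?mulr_ge0 ?unitary_norm_ge0 //; last first.
  by apply: sumr_ge0 => m _; rewrite !mulr_ge0 ?cabs_ge0.
by rewrite exprMn !sqr_unitary_norm cauchy_schwarz_weighted.
Qed.

(* The conjugate of w attains equality in the Cauchy-Schwarz inequality. *)
Definition conj_dhomog w : dhomog n C k := indhomog k (map_mpoly conjc w).

Lemma mcoeff_conj_dhomog w m : (conj_dhomog w)@_m = ((w@_m)^*)%C.
Proof.
rewrite /conj_dhomog /indhomog val_insubd.
(* [indhomog] falls back on a default unless its argument is homogeneous; conjugation creates no new
   monomials. *)
have -> : map_mpoly conjc w \is k.-homog; last by rewrite mcoeff_map_mpoly.
apply/dhomogP => m'; rewrite mcoeff_msupp mcoeff_map_mpoly /= => cw.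
apply: (dhomog_mf (dhomog_is_dhomog w)); rewrite mcoeff_msupp.
by apply: contraNneq cw => ->; rewrite conjc0.
Qed.

Lemma unitary_norm_conj w : unitary_norm (conj_dhomog w) = unitary_norm w.
Proof.
rewrite !unitary_normE; congr Num.sqrt; apply: eq_bigr => m _.
rewrite mcoeff_conj_dhomog; congr (_ * _ ^+ 2).
by case: w@_m => a b; rewrite /cabs /= sqrrN.
Qed.

Lemma sym_pairing_conj w :
  sym_pairing (conj_dhomog w) w = ((unitary_norm w ^+ 2)%:C)%C.
Proof.
rewrite sym_pairingE sqr_unitary_norm rmorph_sum /=; apply: eq_bigr => m _.
by rewrite mcoeff_conj_dhomog -mulrA [_^*%C * _]mulrC -cabs_sqr -rmorphM.
Qed.

Lemma sym_pairingZ c h w : sym_pairing (c *: h) w = c * sym_pairing h w.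
Proof.
rewrite !sym_pairingE mulr_sumr; apply: eq_bigr => m _ /=.
by rewrite mcoeffZ !mulrA [_ * c]mulrC.
Qed.

(** Cauchy-Schwarz bounds the supremum, and the conjugate of [w] divided by its norm attains the
    bound. *)
Lemma sym_normE w : sym_norm w = unitary_norm w.
Proof.
rewrite /sym_norm; set A := (X in sup X).
have ubA : ubound A (unitary_norm w).
  move=> _ [h /= h1 <-].
  by rewrite (le_trans (cabs_sym_pairing_le _ _)) // h1 mul1r.
(* A tensor of norm 0 cannot be normalised. Then [A] is either empty, with [sup] equal to 0 by
   convention, or squeezed between 0 and its upper bound 0. *)
have [w0|wn0] := eqVneq (unitary_norm w) 0.
  have [->|/set0P A0] := eqVneq A set0; first by rewrite sup0 w0.
  apply/le_anti; rewrite ge_sup //= w0.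
  have [x Ax] := A0; apply: (@le_trans _ _ x).
    by case: Ax => h _ <-; apply: cabs_ge0.
  by apply: ub_le_sup => //; exists (unitary_norm w).
have Aw : A (unitary_norm w).
  exists ((unitary_norm w)^-1%:C%C *: conj_dhomog w) => /=.
    rewrite unitary_normZ unitary_norm_conj.
    by rewrite cabs_real ?invr_ge0 ?unitary_norm_ge0 ?mulVf.
  rewrite sym_pairingZ sym_pairing_conj -rmorphM expr2 mulKf //.
  by rewrite cabs_real ?unitary_norm_ge0.
apply/le_anti; rewrite ge_sup ?ub_le_sup //; last by exists (unitary_norm w).
by exists (unitary_norm w).
Qed.

Lemma sym_derivE p q w : sym_deriv p q w = (diffop p w).@[q 0].
Proof.
by rewrite /sym_deriv /diffop raddf_sum /=; apply: eq_bigr => m _; rewrite mevalZ.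
Qed.

Lemma sym_derivZ p q c w : sym_deriv p q (c *: w) = c * sym_deriv p q w.
Proof. by rewrite !sym_derivE linearZ /= mevalZ. Qed.

(** A crude bound suffices: it makes every value on a unit tensor at most the supremum defining the
    operator norm. *)
Lemma sym_deriv_bounded p q :
  exists M, forall w, unitary_norm w = 1 -> cabs (sym_deriv p q w) <= M.
Proof.
(* With a the weight of [m], unit norm gives |w_m|^2 <= 1/a. Either |w_m| <= 1, or |w_m| <= |w_m|^2
   <= 1/a; the constant 1 + 1/a covers both cases. *)
exists (\sum_(m : 'X_{1..n < k.+1})
  (1 + (multinom_inv R k m)^-1) * cabs (p^`M[m]).@[q 0]) => w w1.
rewrite /sym_deriv sum_msupp_dhomog => [|m ->]; last by rewrite mul0r.
rewrite (le_trans (cabs_sum _ _ _)) // ler_sum // => m _.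
rewrite cabsM ler_wpM2r ?cabs_ge0 //.
have a0 := multinom_inv_gt0 m.
have: multinom_inv R k m * cabs w@_m ^+ 2 <= 1.
  rewrite -[leRHS](expr1n _ 2) -w1 sqr_unitary_norm (bigD1 m) //= lerDl.
  by apply: sumr_ge0 => j _; rewrite mulr_ge0 ?sqr_ge0 ?(ltW (multinom_inv_gt0 _)).
rewrite mulrC -ler_pdivlMr // div1r => le2.
have [le1|lt1] := leP (cabs w@_m) 1.
  by rewrite (le_trans le1) // lerDl invr_ge0 ltW.
rewrite (le_trans _ (le_trans le2 _)) ?lerDr //.
by rewrite expr2 ler_peMl ?cabs_ge0 // ltW.
Qed.

Lemma sym_deriv_norm_ge0 p q : 0 <= sym_deriv_norm k p q.
Proof.
rewrite /sym_deriv_norm; set A := (X in sup X).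
have [->|/set0P [x Ax]] := eqVneq A set0; first by rewrite sup0.
have [M ubM] := sym_deriv_bounded p q.
have ubA : has_ubound A.
  by exists M => _ [w /= w1 <-]; apply: ubM; rewrite -sym_normE.
apply: le_trans (ub_le_sup ubA Ax).
by case: Ax => w _ <-; apply: cabs_ge0.
Qed.

Lemma cabs_sym_deriv_le p q w :
  cabs (sym_deriv p q w) <= sym_deriv_norm k p q * unitary_norm w.
Proof.
have [w0|wn0] := eqVneq (unitary_norm w) 0.
  rewrite (unitary_norm_eq0 w0) -(scale0r (0 : dhomog n C k)).
  rewrite sym_derivZ mul0r cabs0.
  by rewrite mulr_ge0 ?sym_deriv_norm_ge0 ?unitary_norm_ge0.
have wgt0 : 0 < unitary_norm w by rewrite lt_neqAle eq_sym wn0 unitary_norm_ge0.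
rewrite -ler_pdivrMr // mulrC.
have iw0 : 0 <= (unitary_norm w)^-1 by rewrite invr_ge0 ltW.
rewrite -[X in X * _](cabs_real iw0) -cabsM -sym_derivZ.
have [M ubM] := sym_deriv_bounded p q.
apply: ub_le_sup.
  by exists M => _ [u /= u1 <-]; apply: ubM; rewrite -sym_normE.
exists ((unitary_norm w)^-1%:C%C *: w) => //=.
by rewrite sym_normE unitary_normZ cabs_real // mulVf.
Qed.

End Degree.
End Norms.

(** * Norms of powers of vectors, and the meaning of a positive residual *)

Section Residual.
Variables (R : realType) (n : nat).
Local Notation C := R[i].
Implicit Types (p : {mpoly C[n]}) (v z zhat : 'rV[C]_n).

Definition sym_power v k : dhomog n C k := DHomog (linform_expr_homog (v 0) k).

(** After squaring, the term of weight m!/k! is (m!/k!) (k!/m!)^2 |v^m|^2 = (k!/m!) |v^m|^2, a term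
    of the multinomial expansion of (|v_1|^2 + ... + |v_n|^2)^k. *)
Lemma unitary_norm_sym_power v k : unitary_norm (sym_power v k) = hnorm v ^+ k.
Proof.
apply: (pexpIrn (n := 2)) => //; rewrite ?nnegrE ?exprn_ge0 ?sqrtr_ge0 //.
rewrite sqr_unitary_norm /= exprAC sqr_sqrtr; last first.
  by apply: sumr_ge0 => i _; rewrite sqr_ge0.
pose u i := cabs (v 0 i) ^+ 2.
(* Evaluating [linform u ^+ k] at the all-ones point sums its coefficients, so that both sides range
   over the same monomials. *)
have -> : \sum_i cabs (v 0 i) ^+ 2 = (linform u).@[fun=> 1].
  rewrite /linform raddf_sum /=; apply: eq_bigr => i _.
  by rewrite mevalZ mevalXU mulr1.
rewrite -[RHS]rmorphXn /= mevalE (sum_msupp_wide (k := k.+1)); first last.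
- by move=> m ->; rewrite mul0r.
- exact/msize_homog/linform_expr_homog.
apply: eq_bigr => m _; rewrite [\prod_i 1 ^+ _]big1 ?mulr1; last first.
  by move=> i _; rewrite expr1n.
set P := (\prod_(i < n) (m i)`!)%N.
have P0 : (P%:R : R) != 0.
  by rewrite pnatr_eq0 -lt0n prodn_gt0 // => i; apply: fact_gt0.
have PC0 : (P%:R : C) != 0.
  by rewrite pnatr_eq0 -lt0n prodn_gt0 // => i; apply: fact_gt0.
have k0 : (k`!%:R : R) != 0 by rewrite pnatr_eq0 -lt0n fact_gt0.
have := mcoeff_linformX u k m; have := mcoeff_linformX (v 0) k m.
case: eqP => _; last first.
  move=> /eqP; rewrite mulf_eq0 (negPf PC0) orbF => /eqP ->.
  move=> /eqP; rewrite mulf_eq0 (negPf P0) orbF => /eqP ->.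
  by rewrite cabs0 expr0n mulr0.
move=> Ev Eu; apply: (mulIf P0); rewrite Eu.
have cabs_nat j : cabs (j%:R : C) = j%:R.
  by rewrite -[RHS]cabs_real ?ler0n // rmorph_nat.
have /(congr1 (@cabs R)) := Ev; rewrite !cabsM !cabs_nat cabs_prod => Ec.
have -> : \prod_i u i ^+ m i = (\prod_i cabs (v 0 i ^+ m i)) ^+ 2.
  by rewrite -prodrXl; apply: eq_bigr => i _; rewrite cabsX /u -!exprM mulnC.
apply: (mulIf k0); rewrite /multinom_inv -/P.
transitivity ((cabs (linform (v 0) ^+ k)@_m * P%:R) ^+ 2); first by field.
by rewrite Ec; ring.
Qed.

Lemma taylor_residual_gt0_neq0 p zhat z r :
  hnorm (z - zhat) < r -> 0 < taylor_residual p zhat r -> p.@[z 0] != 0.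
Proof.
move=> zr res; apply/eqP => pz; move: res; apply/negP; rewrite -leNgt.
rewrite /taylor_residual subr_le0.
(* Since [msize 0 = 0], the Taylor sum of the zero polynomial has no constant term to split off. *)
have [->|pn0] := eqVneq p 0.
  by rewrite meval0 cabs0 msize0 big_geq.
pose v := z - zhat.
have := taylor_diffop p (zhat 0) (v 0).
have -> : p.@[fun i => zhat 0 i + v 0 i] = p.@[z 0].
  by apply: meval_eq => i; rewrite /v !mxE addrCA subrr addr0.
have p0 : (0 < msize p)%N by rewrite lt0n msize_poly_eq0.
pose t k := (diffop p (linform (v 0) ^+ k)).@[zhat 0] / k`!%:R.
rewrite pz -(big_mkord predT t) /t.
rewrite big_ltn //= expr0 -mpolyX0 diffopX mderivm0m divr1.
(* The constant term is the value of [p] at [zhat]; as [p] vanishes at [z], it is the opposite of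
   the sum of the higher terms. *)
move=> /esym/eqP; rewrite addr_eq0 => /eqP ->.
have cabsN (x : C) : cabs (- x) = cabs x.
  by case: x => a b; rewrite /cabs /= !sqrrN.
rewrite cabsN (le_trans (cabs_sum _ _ _)) // ler_sum // => k _.
have fk : (0 : R) < k`!%:R by rewrite ltr0n fact_gt0.
have -> : (k`!%:R : C)^-1 = (k`!%:R^-1)%:C%C by rewrite fmorphV rmorph_nat.
rewrite cabsM cabs_real ?invr_ge0 ?(ltW fk) // [leRHS]mulrAC ler_pM2r ?invr_gt0 //.
rewrite -[diffop _ _]/(diffop p (sym_power v k)) -sym_derivE.
rewrite (le_trans (cabs_sym_deriv_le _ _ _)) // unitary_norm_sym_power.
rewrite ler_wpM2l ?sym_deriv_norm_ge0 // lerXn2r ?nnegrE ?sqrtr_ge0 ?(ltW zr) //.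
exact: le_trans (sqrtr_ge0 _) (ltW zr).
Qed.

(** At a common zero every single residual is at most 0, and so is their maximum; the initial value
    [-oo] settles the empty system. *)
Lemma system_residual_gt0_notin_zeros N (f : 'I_N -> {mpoly C[n]}) zhat z r :
  hnorm (z - zhat) < r -> (0%:E < system_residual f zhat r)%E -> ~ zeros f z.
Proof.
move=> zr res fz.
suff : (system_residual f zhat r <= 0%:E)%E by rewrite leNgt res.
apply/bigmax_leP; split=> [|i _]; first exact: leNye.
rewrite lee_fin leNgt; apply/negP => /(taylor_residual_gt0_neq0 zr).
by rewrite fz eqxx.
Qed.

End Residual.

(** * Counting the associated solutions *)

Lemma inj_fset_card_surj (T U : choiceType) (A : {fset T}) (B : set U) d
    (h : T -> U) :
  (B #= `I_d)%card -> #|` A| = d -> (forall x, x \in A -> B (h x)) ->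
  {in A &, injective h} -> forall y, B y -> exists2 x, x \in A & h x = y.
Proof.
move=> Bd Ad AB h_inj y By.
have finB : finite_set B by apply/finite_setP; exists d.
(* By injectivity the image has [d] elements, as many as [B], so its inclusion in [B] is an
   equality. *)
have imA : (h @` A)%fset = fset_set B.
  apply/eqP; rewrite eqEfcard (card_fset_set Bd) card_in_imfset // Ad leqnn andbT.
  by apply/fsubsetP => _ /imfsetP[x /= xA ->]; 
     rewrite in_fset_set // inE; apply: AB.
have : y \in fset_set B by rewrite in_fset_set // inE.
by rewrite -imA => /imfsetP[x xA ->]; exists x.
Qed.

Theorem theorem3p2 (R : realType) (n N d : nat)
    (f : 'I_N -> {mpoly R[i][n]}) (g : 'I_n -> {mpoly R[i][n]})
    (Ng : refinement R n) (S : {fset 'rV[R[i]]_n}) (rho : 'rV[R[i]]_n -> R) :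
  (n <= N)%N ->
  square_subsystem f g ->
  ((zeros g `\` zeros f) #= `I_d)%card ->
  (forall z, z \in S -> approximate_solution g z (rho z) Ng) ->
  (forall z1 z2 zeta1 zeta2, z1 \in S -> z2 \in S ->
     associated_solution g z1 (rho z1) Ng zeta1 ->
     associated_solution g z2 (rho z2) Ng zeta2 ->
     z1 <> z2 -> zeta1 <> zeta2) ->
  forall z, z \in certified f d S rho -> approximate_solution f z (rho z) Ng.
Proof.
move=> _ _ card_d approx distinct z; rewrite /certified.
case: eqP => [card_rej|_]; last by rewrite inE.
rewrite inE => /andP[zNrej zS].
(* One associated solution is chosen for each point of [S]; the value 0 outside [S] only makes the
   function total. *)
have /choice[zeta zetaP] (x : 'rV[R[i]]_n) :
    exists y, x \in S -> associated_solution g x (rho x) Ng y.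
  have [xS|_] := boolP (x \in S); last by exists 0.
  by have [_ [y xy]] := approx x xS; exists y.
have [rho_gt0 _] := approx z zS; split=> //; exists (zeta z).
(* Distance and convergence do not depend on the system, so only the vanishing of [f] at [zeta z] is
   at stake. *)
have [gz ? ?] := zetaP z zS; split=> //; apply: contrapT => fNz.
have rejS x : x \in rejected f S rho -> x \in S by rewrite !inE => /andP[].
have zeta_rej x : x \in rejected f S rho -> (zeros g `\` zeros f) (zeta x).
  rewrite !inE => /andP[xS res]; have [gx xr _] := zetaP x xS.
  by split=> //; apply: system_residual_gt0_notin_zeros xr res.
have zeta_inj : {in rejected f S rho &, injective zeta}.
  move=> x y xR yR xy; apply: contrapT => /distinct; apply; [..|exact: xy].
  - exact: rejS.
  - exact: rejS.
  - exact/zetaP/rejS.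
  - exact/zetaP/rejS.
(* If [zeta z] were not a zero of [f], some rejected [x] would share it with [z]; distinctness then
   contradicts that [z] is not rejected. *)
have [x xR xz] :=
  inj_fset_card_surj card_d card_rej zeta_rej zeta_inj (conj gz fNz).
apply: (distinct x z (zeta x) (zeta z)) xz => //; [exact: rejS|..].
- exact/zetaP/rejS.
- by move=> xz; rewrite -xz xR in zNrej.
Qed.
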